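(* Let $X,Y$ be Banach spaces over the same scalar field, let $\mathscr{A}$ be a nonempty set of infinite matrices $A=(A_{n,k}:n,k\in\omega)$ of bounded linear operators in $\mathcal{B}(X,Y)$, and fix $T\in\mathcal{B}(X,Y)$. Let $\mathcal{I},\mathcal{J}$ be ideals on $\omega$ such that $\mathcal{J}$ is countably generated. Then $\mathscr{A}$ is $(\mathcal{I},\mathcal{J})$-regular with respect to $T$ if and only if all of the following hold: (U1) $\sup_n\|A_{n,\omega}\|<\infty$ for all $A\in\mathscr{A}$; (U2) $\sup_{A\in\mathscr{A}}\sup_{n\in J}\|A_{n,\omega}\|<\infty$ for some $J\in\mathcal{J}^\star$; (U3) $c^b(X,\mathcal{I})\subseteq\mathrm{dom}(A)$ for all $A\in\mathscr{A}$; (U4) $\mathcal{J}\text{-}\lim_n\sum_k A_{n,k}=T$ uniformly on $A\in\mathscr{A}$ (in the strong operator topology); (U5) for all $\bm{x}\in c_{00}^b(X,\mathcal{I})$, $\mathcal{J}\text{-}\lim A\bm{x}=0$ uniformly on $A\in\mathscr{A}$.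
   Context: $\omega=\{0,1,2,\ldots\}$. $\mathcal{B}(X,Y)$ is the space of bounded linear operators $X\to Y$. An ideal on $\omega$ is a family $\mathcal{I}$ of subsets of $\omega$ closed under finite unions and subsets; it is always assumed that $\omega\notin\mathcal{I}$ and that $\mathcal{I}$ contains all finite subsets of $\omega$. $\mathcal{I}^\star:=\{\omega\setminus S:S\in\mathcal{I}\}$. $\mathcal{I}$ is countably generated if there is a sequence $(S_n)_{n\in\omega}$ in $\mathcal{I}$ such that for all $S\subseteq\omega$: $S\in\mathcal{I}$ iff $S\subseteq\bigcup_{n\in F}S_n$ for some finite $F\subseteq\omega$. A sequence $(x_n)$ is $\mathcal{I}$-convergent to $\eta$ ($\mathcal{I}\text{-}\lim\bm{x}=\eta$) if $\{n:x_n\notin U\}\in\mathcal{I}$ for every neighborhood $U$ of $\eta$. For a matrix $A=(A_{n,k})$ of linear operators from $X$ to $Y$, $\mathrm{dom}(A)$ is the set of $\bm{x}=(x_k)\in X^\omega$ such that $\sum_kA_{n,k}x_k$ converges in $Y$ for every $n$; then $A_n\bm{x}:=\sum_kA_{n,k}x_k$ and $A\bm{x}:=(A_n\bm{x}:n\in\omega)$. The group norm of the $n$th row is $$\|A_{n,\omega}\|:=\sup\Big\{\Big\|\sum_{k\in F}A_{n,k}x_k\Big\|: F\subseteq\omega\text{ finite and each }x_k\text{ in the closed unit ball of }X\Big\}\in[0,\infty].$$ $\ell_\infty(X)$ is the space of bounded sequences in $X$; $c^b(X,\mathcal{I})$ is the space of bounded $\mathcal{I}$-convergent sequences in $X$;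 $c_{00}^b(X,\mathcal{I})$ is the space of bounded sequences $\bm{x}$ in $X$ with $\{n:x_n\neq0\}\in\mathcal{I}$. $(\mathcal{C},\mathcal{D})$, for $\mathcal{C}\subseteq X^\omega$, $\mathcal{D}\subseteq Y^\omega$, denotes the set of matrices $A$ with $\mathcal{C}\subseteq\mathrm{dom}(A)$ and $A\bm{x}\in\mathcal{D}$ for all $\bm{x}\in\mathcal{C}$. ''$\mathcal{J}\text{-}\lim A\bm{x}=\eta$ uniformly on $A\in\mathscr{A}$'' means: for every neighborhood $U$ of $\eta$ there is $S\in\mathcal{J}^\star$ with $A_n\bm{x}\in U$ for all $n\in S$ and all $A\in\mathscr{A}$. Limits of operators are in the strong operator topology, so (U4) means: for every $x\in X$, $\mathcal{J}\text{-}\lim_n\sum_kA_{n,k}x=Tx$ uniformly on $A\in\mathscr{A}$. $\mathscr{A}$ is $(\mathcal{I},\mathcal{J})$-regular with respect to $T$ if $A\in(c^b(X,\mathcal{I}),c^b(Y,\mathcal{J}))$ for all $A\in\mathscr{A}$ and, for all $\bm{x}\in c^b(X,\mathcal{I})$, $\mathcal{J}\text{-}\lim A\bm{x}=T(\mathcal{I}\text{-}\lim\bm{x})$ uniformly on $A\in\mathscr{A}$. *)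

(* Defs.v *)
From HB Require Import structures.
From mathcomp Require Import all_boot all_order all_algebra finmap.
From mathcomp Require Import complex.
From mathcomp Require Import all_classical all_reals all_analysis.

Set Implicit Arguments.
Unset Strict Implicit.
Unset Printing Implicit Defensive.

Import Order.TTheory GRing.Theory Num.Theory.
Import numFieldNormedType.Exports.

Local Open Scope classical_set_scope.
Local Open Scope ring_scope.

Variant scalar_kind := RealScalars | ComplexScalars.

Definition scalar_field (R : realType) (s : scalar_kind) : numFieldType :=
  match s with
  | RealScalars => R
  | ComplexScalars => R[i]
  end.

Definition scalar_re (R : realType) (s : scalar_kind) : scalar_field R s -> R :=
  match s return scalar_field R s -> R with
  | RealScalars => fun z => z
  | ComplexScalars => fun z => complex.Re z
  end.

(* The library's norm on a normed module over K takes its values in K; for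
   K = R[i] these values are nonnegative reals, so nothing is lost here. *)
Definition rnorm (R : realType) (s : scalar_kind)
    (V : normedModType (scalar_field R s)) (v : V) : R :=
  scalar_re `|v|.

Record bounded_op (K : numFieldType) (X Y : normedModType K) := BoundedOp {
  bounded_op_linear :> {linear X -> Y};
  bounded_op_bounded :
    exists M : K, forall x, `|bounded_op_linear x| <= M * `|x|
}.

Record is_ideal (I : set (set nat)) : Prop := IsIdeal {
  ideal_setU : forall A B, I A -> I B -> I (A `|` B);
  ideal_subset : forall A B, A `<=` B -> I B -> I A;
  ideal_proper : ~ I setT;
  ideal_finite : forall A, finite_set A -> I A
}.

Definition dual_filter (I : set (set nat)) : set (set nat) := setC @` I.

Definition countably_generated (I : set (set nat)) : Prop :=
  exists S : nat -> set nat, (forall n, I (S n)) /\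
    forall B : set nat, I B <->
      exists2 F : set nat, finite_set F & B `<=` \bigcup_(n in F) S n.

Definition ideal_cvg (V : topologicalType) (I : set (set nat))
    (x : nat -> V) (eta : V) : Prop :=
  forall U, nbhs eta U -> I [set n | ~ U (x n)].

Section Spaces.
Variables (K : numFieldType) (X : normedModType K).

Definition linfty : set (nat -> X) := bounded_fun.

Definition cb (I : set (set nat)) : set (nat -> X) :=
  [set x | linfty x /\ exists eta, ideal_cvg I x eta].

Definition c00b (I : set (set nat)) : set (nat -> X) :=
  [set x | linfty x /\ I [set n | x n != 0]].

End Spaces.
Arguments cb {K} X I.
Arguments c00b {K} X I.

Definition opmatrix (K : numFieldType) (X Y : normedModType K) :=
  nat -> nat -> bounded_op X Y.

Section Matrices.
Variables (K : numFieldType) (X Y : normedModType K).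
Implicit Types (A : opmatrix X Y) (x : nat -> X).

Definition row_terms A n x : nat -> Y := fun k => A n k (x k).

Definition dom A : set (nat -> X) :=
  [set x | forall n, cvgn (series (row_terms A n x))].

(* Meaningful for x in dom A only: otherwise limn returns a default value. *)
Definition mxapp A x : nat -> Y := fun n => limn (series (row_terms A n x)).

Definition mxclass (C : set (nat -> X)) (D : set (nat -> Y)) :
    set (opmatrix X Y) :=
  [set A | C `<=` dom A /\ forall x, C x -> D (mxapp A x)].

Definition unif_ideal_lim (J : set (set nat)) (AA : set (opmatrix X Y))
    (x : nat -> X) (eta : Y) : Prop :=
  forall U, nbhs eta U -> exists2 S, dual_filter J S &
    forall n A, S n -> AA A -> U (mxapp A x n).

Definition ideal_regular (I J : set (set nat)) (AA : set (opmatrix X Y))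
    (T : bounded_op X Y) : Prop :=
  (forall A, AA A -> mxclass (cb X I) (cb Y J) A) /\
  (forall x eta, cb X I x -> ideal_cvg I x eta ->
    unif_ideal_lim J AA x (T eta)).

End Matrices.

Definition group_norm (R : realType) (s : scalar_kind)
    (X Y : normedModType (scalar_field R s)) (A : opmatrix X Y) (n : nat) : \bar R :=
  ereal_sup [set r | exists (F : {fset nat}) (x : nat -> X),
    (forall k, rnorm (x k) <= 1) /\
    r = (rnorm (\sum_(k <- F) A n k (x k)))%:E].

(* Main.v *)
(* The conditions (U1) and (U2) come from a uniform boundedness principle on the
   Banach space c_0(X), all of whose elements lie in c^b(X, I): if a sequence of
   families F_0, F_1, ... of bounded operators c_0(X) -> Y is such that every x
   is bounded by j on some F_j, then by Baire's argument some F_j is uniformly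
   bounded.  It is used three times: for the partial sums of one row of A (so
   that each row is a bounded operator), for the rows of A (giving U1), and for
   the rows with index outside S_0 u ... u S_(j-1) of all A in AA, where the S_i
   generate J (giving U2).  The operator norm of a row on c_0(X) is its group
   norm.
   Conversely, x - eta is split at a small threshold into a bounded sequence
   supported on a set of I, handled by U5, and a uniformly small sequence,
   handled by U2; the constant sequence eta is handled by U4. *)

Require Import Defs.
From HB Require Import structures.
From mathcomp Require Import all_boot all_order all_algebra finmap.
From mathcomp Require Import complex.
From mathcomp Require Import all_classical all_reals all_analysis.
From mathcomp Require Import lra.

Set Implicit Arguments.
Unset Strict Implicit.
Unset Printing Implicit Defensive.

Import Order.TTheory GRing.Theory Num.Theory.
Import numFieldNormedType.Exports.

Local Open Scope classical_set_scope.
Local Open Scope ring_scope.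

(** * Real-valued norms over both scalar fields *)

Section RealNorm.
Variables (R : realType) (s : scalar_kind).
Implicit Types (V : normedModType (scalar_field R s)) (a b r : R).

Definition scalar_of_real : R -> scalar_field R s :=
  match s return R -> scalar_field R s with
  | RealScalars => fun r => r
  | ComplexScalars => fun r => (r%:C)%C
  end.

Lemma scalar_of_realK : cancel scalar_of_real (@scalar_re R s).
Proof. by rewrite /scalar_of_real; case: s. Qed.

Lemma scalar_re_le (z w : scalar_field R s) :
  z <= w -> scalar_re z <= scalar_re w.
Proof.
by move: z w; case: s => //= z w; rewrite lecE => /andP[].
Qed.

Lemma scalar_re_lt (z w : scalar_field R s) :
  z < w -> scalar_re z < scalar_re w.
Proof.
by move: z w; case: s => //= z w; rewrite ltcE => /andP[].
Qed.

Lemma scalar_reD (z w : scalar_field R s) :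
  scalar_re (z + w) = scalar_re z + scalar_re w.
Proof. by move: z w; case: s => //= -[? ?] [? ?]. Qed.

Lemma scalar_reMl (z : scalar_field R s) r :
  scalar_re (z * scalar_of_real r) = scalar_re z * r.
Proof.
by rewrite /scalar_of_real; move: z; case: s => //= -[z1 z2] /=; rewrite mulr0 subr0.
Qed.

Lemma scalar_re0 : scalar_re (0 : scalar_field R s) = 0.
Proof. by case: s. Qed.

(** The order on [R[i]] compares only numbers with equal imaginary parts, so a nonnegative scalar is
    real. This carries estimates between the scalar-valued norm and [rnorm]. *)
Lemma scalar_ge0E (z : scalar_field R s) :
  0 <= z -> z = scalar_of_real (scalar_re z).
Proof.
rewrite /scalar_of_real; move: z; case: s => [z //|[z1 z2]].
by rewrite lecE /= => /andP[/eqP -> _].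
Qed.

Lemma scalar_of_real_lt a b :
  (scalar_of_real a < scalar_of_real b) = (a < b).
Proof. by rewrite /scalar_of_real; case: s => //=; rewrite ltcE /= eqxx. Qed.

Lemma scalar_of_real_le a b :
  (scalar_of_real a <= scalar_of_real b) = (a <= b).
Proof. by rewrite /scalar_of_real; case: s => //=; rewrite lecE /= eqxx. Qed.

Lemma scalar_of_real0 : scalar_of_real 0 = 0.
Proof. by rewrite [RHS](@scalar_ge0E 0) // scalar_re0. Qed.

Lemma scalar_of_real_mul a b :
  scalar_of_real (a * b) = scalar_of_real a * scalar_of_real b.
Proof. by rewrite /scalar_of_real; case: s => //=; rewrite rmorphM. Qed.

Lemma normr_rnorm V (v : V) : `|v| = scalar_of_real (rnorm v).
Proof. exact: scalar_ge0E. Qed.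

Lemma rnorm_ge0 V (v : V) : 0 <= rnorm v.
Proof. by rewrite -[0]scalar_re0; apply: scalar_re_le. Qed.

Lemma rnorm0 V : rnorm (0 : V) = 0.
Proof. by rewrite /rnorm normr0 scalar_re0. Qed.

Lemma rnormN V (v : V) : rnorm (- v) = rnorm v.
Proof. by rewrite /rnorm normrN. Qed.

Lemma rnormB V (u v : V) : rnorm (u - v) = rnorm (v - u).
Proof. by rewrite -rnormN opprB. Qed.

Lemma rnormD V (u v : V) : rnorm (u + v) <= rnorm u + rnorm v.
Proof. by rewrite /rnorm -scalar_reD; apply/scalar_re_le/ler_normD. Qed.

Lemma rnorm_sum V (I : Type) (t : seq I) (f : I -> V) :
  rnorm (\sum_(i <- t) f i) <= \sum_(i <- t) rnorm (f i).
Proof.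
elim: t => [|i t IH]; first by rewrite !big_nil rnorm0.
by rewrite !big_cons (le_trans (rnormD _ _)) // lerD2l.
Qed.

Lemma rnormZ V r (v : V) : 0 <= r ->
  rnorm (scalar_of_real r *: v) = r * rnorm v.
Proof.
move=> r0; rewrite /rnorm normrZ [X in X * _]ger0_norm; last first.
  by rewrite -scalar_of_real0 scalar_of_real_le.
by rewrite normr_rnorm -scalar_of_real_mul !scalar_of_realK.
Qed.

Lemma nbhs_rnormP V (v : V) (U : set V) :
  nbhs v U <-> exists2 e, 0 < e & forall w, rnorm (v - w) < e -> U w.
Proof.
split=> [/nbhs_normP[e /= e0 eU]|[e e0 eU]].
  exists (scalar_re e); first by rewrite -[0]scalar_re0; apply: scalar_re_lt.
  move=> w vw; apply: eU => /=.
  by rewrite (scalar_ge0E (ltW e0)) normr_rnorm scalar_of_real_lt.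
apply/nbhs_normP; exists (scalar_of_real e) => /=.
  by rewrite -scalar_of_real0 scalar_of_real_lt.
by move=> w /=; rewrite normr_rnorm scalar_of_real_lt; apply: eU.
Qed.

Lemma cvgn_rnormP V (u : nat -> V) (l : V) :
  u @ \oo --> l <->
  forall e, 0 < e -> exists N, forall n, (N <= n)%N -> rnorm (l - u n) < e.
Proof.
split=> [/cvgrPdist_lt ul e e0|ul].
  have /ul[N _ NP] : 0 < scalar_of_real e.
    by rewrite -scalar_of_real0 scalar_of_real_lt.
  by exists N => n /NP /=; rewrite normr_rnorm scalar_of_real_lt.
apply/cvgrPdist_lt => e e0.
have [|N NP] := ul (scalar_re e).
  by rewrite -[0]scalar_re0; apply: scalar_re_lt.
exists N => // n /NP /=.
by rewrite [in X in _ -> X](scalar_ge0E (ltW e0)) normr_rnorm scalar_of_real_lt.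
Qed.

Lemma limn_eq V (u : nat -> V) (l : V) : u @ \oo --> l -> limn u = l.
Proof. by move=> ul; apply: cvg_lim => //; apply: norm_hausdorff. Qed.

Lemma linfty_rnormP V (u : nat -> V) :
  linfty u <-> exists M, forall n, rnorm (u n) <= M.
Proof.
rewrite /linfty /=; split.
  move=> [M [_ uM]]; exists (scalar_re (M + 1)) => n.
  by apply/scalar_re_le/uM => //; rewrite ltrDl.
move=> [M uM]; exists (scalar_of_real M); split.
  by apply: ger0_real; rewrite -scalar_of_real0 scalar_of_real_le
    (le_trans _ (uM 0)) ?rnorm_ge0.
move=> z Mz n _; apply: le_trans (ltW Mz).
by rewrite normr_rnorm scalar_of_real_le.
Qed.

Lemma bounded_op_rnorm (X Y : normedModType (scalar_field R s))
    (f : bounded_op X Y) :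
  exists2 M, 0 <= M & forall x, rnorm (f x) <= M * rnorm x.
Proof.
have [M fM] := bounded_op_bounded f.
(* [M] is an arbitrary scalar. Only its real part enters the real bound, and the absolute value
   makes the constant nonnegative. *)
exists `|scalar_re M| => // x; apply: (@le_trans _ _ (scalar_re M * rnorm x)).
  by rewrite -scalar_reMl -normr_rnorm; apply: scalar_re_le.
by rewrite ler_wpM2r ?rnorm_ge0 ?ler_norm.
Qed.

End RealNorm.

Lemma rnorm_cauchy_cvg (R : realType) (s : scalar_kind)
    (V : completeNormedModType (scalar_field R s)) (u : nat -> V) :
  (forall e, 0 < e -> exists N, forall n, (N <= n)%N ->
     rnorm (u N - u n) < e) -> cvgn u.
Proof.
move=> uC; apply/cauchy_cvgP/cauchy_exP => e e0.
have [|N NP] := uC (scalar_re e).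
  by rewrite -[0](@scalar_re0 R s); apply: scalar_re_lt.
exists (u N); exists N => // n /NP /=.
rewrite -ball_normE /= normr_rnorm [in X in _ -> X](scalar_ge0E (ltW e0)).
by rewrite scalar_of_real_lt.
Qed.

(** * Linear and bounded maps on null sequences *)

Section NullSequences.
Variables (R : realType) (s : scalar_kind).
Variables (X Y : normedModType (scalar_field R s)).
Implicit Types (x y : nat -> X) (f : (nat -> X) -> Y) (r : R).

(** The map is total on sequences but the law is asked on null sequences only, since a row of a
    matrix need not be linear where its series diverge. *)
Definition c0_linear f := forall (a : scalar_field R s) x y,
  x @ \oo --> (0 : X) -> y @ \oo --> (0 : X) ->
  f (fun k => x k + a *: y k) = f x + a *: f y.

(** Here [r] is any positive upper bound of the sup norm of [x], so the normed space c_0(X) need not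
    be built. *)
Definition c0_bounded f := exists C, forall x r, 0 < r ->
  x @ \oo --> (0 : X) -> (forall k, rnorm (x k) <= r) -> rnorm (f x) <= C * r.

Lemma cvg0_lin (a : scalar_field R s) x y :
  x @ \oo --> (0 : X) -> y @ \oo --> (0 : X) ->
  (fun k => x k + a *: y k) @ \oo --> (0 : X).
Proof.
move=> x0 y0; rewrite -[0 in X in _ --> X]addr0 -{2}(scaler0 _ a).
by apply: cvgD => //; apply: cvgZr.
Qed.

Lemma c0_linearZ f (a : scalar_field R s) x :
  c0_linear f -> x @ \oo --> (0 : X) -> f (fun k => a *: x k) = a *: f x.
Proof.
move=> flin x0; have c0 : (fun=> 0 : X) @ \oo --> (0 : X) by exact: cvg_cst.
(* Linearity with scalar -1 at the zero sequence gives f 0 = f 0 - f 0. *)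
have f0 : f (fun=> 0) = 0.
  rewrite -[RHS](subrr (f (fun=> 0))) -scaleN1r -flin //.
  by congr f; apply/funext => k; rewrite scaler0 addr0.
rewrite -[RHS]add0r -f0 -flin //.
by congr f; apply/funext => k; rewrite add0r.
Qed.

Lemma c0_bounded_unit f C :
  c0_linear f -> (forall x, x @ \oo --> (0 : X) ->
    (forall k, rnorm (x k) <= 1) -> rnorm (f x) <= C) ->
  c0_bounded f.
Proof.
move=> flin fC; exists C => x r r0 x0 xr.
have ri0 : 0 <= r^-1 by rewrite invr_ge0 ltW.
have y0 : (fun k => scalar_of_real s r^-1 *: x k) @ \oo --> (0 : X).
  by rewrite -[0 in X in _ --> X](scaler0 _ (scalar_of_real s r^-1)); apply: cvgZr.
have := fC _ y0; rewrite c0_linearZ // rnormZ // ler_pdivrMl // mulrC; apply => k.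
by rewrite rnormZ // ler_pdivrMl // mulr1.
Qed.

End NullSequences.

(** * Uniform boundedness on c_0(X) by nested balls *)

Section UniformBoundedness.
Variables (R : realType) (s : scalar_kind).
Variables (X : completeNormedModType (scalar_field R s)).
Variables (Y : normedModType (scalar_field R s)).
Implicit Types (x y : nat -> X) (f : (nat -> X) -> Y) (r : R).

(* One of x and x + (r/2) z works: r/2 |f z| <= |f (x + (r/2) z)| + |f x|. *)
Lemma c0_blowup_ball f x r (t : R) : c0_linear f -> c0_bounded f ->
  x @ \oo --> (0 : X) -> 0 < r ->
  (exists z, [/\ z @ \oo --> (0 : X), forall k, rnorm (z k) <= 1 &
     4 * (t + 1) / r < rnorm (f z)]) ->
  exists x' r', [/\ x' @ \oo --> (0 : X), 0 < r' <= r / 2,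
    forall k, rnorm (x k - x' k) <= r / 2 &
    forall y, y @ \oo --> (0 : X) -> (forall k, rnorm (x' k - y k) <= r') ->
      t < rnorm (f y)].
Proof.
move=> flin [C fC] x0 r0 [z [z0 z1 fz]].
have r20 : 0 < r / 2 by rewrite divr_gt0.
pose w := fun k => x k + scalar_of_real s (r / 2) *: z k.
have w0 : w @ \oo --> (0 : X) by exact: cvg0_lin.
have [x' [x'0 xx' fx']] : exists x', [/\ x' @ \oo --> (0 : X),
    forall k, rnorm (x k - x' k) <= r / 2 & t + 1 < rnorm (f x')].
  have [fx|fx] := ltP (t + 1) (rnorm (f x)).
    by exists x; split=> // k; rewrite subrr rnorm0 ltW.
  exists w; split=> // [k|].
    rewrite /w opprD addNKr rnormN rnormZ; last exact: ltW.
    by rewrite ler_piMr // ltW.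
  have : r / 2 * rnorm (f z) <= rnorm (f w) + rnorm (f x).
    rewrite -rnormZ; last exact: ltW.
    rewrite -(rnormN (f x)) (le_trans _ (rnormD _ _))//.
    by rewrite /w flin // addrC addKr.
  (* The choice of [z] gives r/2 |f z| > 2 (t + 1), and |f x| accounts for at most t + 1 of it. *)
  move: fz; rewrite ltr_pdivrMr // => fz; nra.
(* On a ball of radius 1/C' the values of [f] stay within 1 of f x', which uses up the spare 1 in t
   + 1. *)
pose C' := `|C| + 1; have C'0 : 0 < C' by rewrite ltr_pwDr.
have iC : 0 < C'^-1 by rewrite invr_gt0.
exists x', (Num.min (r / 2) C'^-1); split=> //.
  by rewrite lt_min r20 iC ge_min lexx.
move=> y y0 xy; rewrite -(ltrD2r 1) (lt_le_trans fx') //.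
pose d := fun k => x' k + (-1) *: y k.
have d0 : d @ \oo --> (0 : X) by exact: cvg0_lin.
have fd : rnorm (f d) <= 1.
  rewrite (le_trans (fC d _ iC d0 _)) //.
    by move=> k; rewrite /d scaleN1r (le_trans (xy k)) // ge_min lexx orbT.
  rewrite ler_pdivrMr // mul1r (le_trans (ler_norm C)) //.
  by rewrite lerDl.
have -> : f x' = f y + f d.
  by rewrite /d flin // scaleN1r subrKC.
by rewrite (le_trans (rnormD _ _)) // lerD2l.
Qed.

(** If no [F j] is bounded on the unit ball, there are nested closed balls with shrinking radii such
    that some member of [F j] exceeds j throughout ball j+1. Their common point violates the
    pointwise hypothesis for every j. *)
Lemma c0_uniform_boundedness (F : nat -> set ((nat -> X) -> Y)) :
  (forall j f, F j f -> c0_linear f /\ c0_bounded f) ->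
  (forall x, x @ \oo --> (0 : X) ->
    exists j, forall f, F j f -> rnorm (f x) <= j%:R) ->
  exists j C, forall f x, F j f -> x @ \oo --> (0 : X) ->
    (forall k, rnorm (x k) <= 1) -> rnorm (f x) <= C.
Proof.
move=> Flin Fpt; apply: contrapT => nbd.
(* A state consists of the stage, the centre and the radius. *)
pose good (p : nat * ((nat -> X) * R)) :=
  p.2.1 @ \oo --> (0 : X) /\ 0 < p.2.2.
(* The premise [good p] gives every state a successor, as dependent choice demands; states that are
   not good satisfy the relation vacuously. *)
pose next (p q : nat * ((nat -> X) * R)) := good p ->
  [/\ q.1 = p.1.+1, good q /\ q.2.2 <= p.2.2 / 2,
    forall k, rnorm (p.2.1 k - q.2.1 k) <= p.2.2 / 2 &
    exists2 f, F p.1 f & forall y, y @ \oo --> (0 : X) ->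
      (forall k, rnorm (q.2.1 k - y k) <= q.2.2) -> p.1%:R < rnorm (f y)].
have step p : {q | next p q}.
  apply: cid; case: p => j [x r]; have [gp|gp] := pselect (good (j, (x, r))).
    have [x0 r0] := gp; have [f Ff [z [z0 z1 fz]]] : exists2 f, F j f &
        exists z, [/\ z @ \oo --> (0 : X), forall k, rnorm (z k) <= 1 &
          4 * (j%:R + 1) / r < rnorm (f z)].
      apply: contrapT => nf; apply: nbd; exists j, (4 * (j%:R + 1) / r).
      move=> f x1 Ff x10 x11; rewrite leNgt; apply/negP => lt.
      by apply: nf; exists f => //; exists x1.
    have [fl fb] := Flin _ _ Ff.
    have [|x' [r' [x'0 /andP[r'0 r'r] xx' fx']]] :=
      @c0_blowup_ball f x r j%:R fl fb x0 r0; first by exists z.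
    by exists (j.+1, (x', r')) => _; split=> //; exists f.
  by exists (j, (x, r)) => /gp.
have [u [u0 uS]] := dependent_choice step (0%N, ((fun=> 0 : X), 1)).
have gu n : (u n).1 = n /\ good (u n).
  elim: n => [|n [IH /uS[-> [gS _] _ _]]]; last by rewrite IH.
  by rewrite u0; split=> //; split=> //=; apply: cvg_cst.
pose xs n := (u n).2.1; pose rs n := (u n).2.2.
have rs0 n : 0 < rs n by have [_ []] := gu n.
have rsS n : rs n.+1 <= rs n / 2 by have [_ /uS[_ []]] := gu n.
have xsS n k : rnorm (xs n k - xs n.+1 k) <= rs n / 2.
  by have [_ /uS[_ _ + _]] := gu n; apply.
(* Half the radius is spent on the next centre; the other half bounds the next radius, hence all
   later moves. *)
have xsD m i k : rnorm (xs i k - xs (i + m)%N k) <= rs i.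
  elim: m i => [|m IH] i; first by rewrite addn0 subrr rnorm0 ltW.
  rewrite addnS -addSn -(subrKA (xs i.+1 k)) (le_trans (rnormD _ _)) //.
  have := xsS i k; have := IH i.+1; have := rsS i; lra.
have rs_small e : 0 < e -> exists n, rs n < e.
  (* Halving gives more, but a decay of 1/(n+1) suffices and follows from (n+2)/2 <= n+1. *)
  move=> e0; have rsn n : n.+1%:R * rs n <= 1.
    elim: n => [|n IH]; first by rewrite mul1r /rs u0.
    have nr0 : 0 <= n%:R * rs n by rewrite mulr_ge0 // ltW.
    rewrite (le_trans (ler_wpM2l _ (rsS n))) //.
    by have := rs0 n; move: IH; rewrite -[n.+2%:R]natr1 -[n.+1%:R]natr1; lra.
  exists (Num.truncn e^-1); rewrite -(ltr_pM2l (_ : 0 < e^-1)) ?invr_gt0 //.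
  rewrite mulVf ?gt_eqF //; apply: lt_le_trans (rsn (Num.truncn e^-1)).
  by rewrite ltr_pM2r // truncnS_gt.
(* Completeness of [X] is used coordinatewise; the bound [xsD], uniform in k, then passes to the
   limit. *)
have xs_cvg k : cvgn (xs^~ k).
  apply: rnorm_cauchy_cvg => e /rs_small[n rne]; exists n => m nm.
  by rewrite -(subnKC nm) (le_lt_trans (xsD _ _ _)).
pose x k := limn (xs^~ k).
have xs_x n k : rnorm (xs n k - x k) <= rs n.
  apply/ler_addgt0Pr => e e0.
  have /cvgn_rnormP/(_ e e0)[N NP] := xs_cvg k.
  rewrite -(subrKA (xs (n + N)%N k)) (le_trans (rnormD _ _)) //.
  by rewrite lerD // rnormB ltW // NP ?leq_addl.
(* A uniform limit of null sequences is null: one centre close to [x] is enough. *)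
have x0 : x @ \oo --> (0 : X).
  apply/cvgn_rnormP => e e0; have e20 : 0 < e / 2 by rewrite divr_gt0.
  have [n rne] := rs_small _ e20.
  have [_ [/cvgn_rnormP/(_ _ e20)[N NP] _]] := gu n.
  exists N => k /NP; rewrite !sub0r !rnormN => xke.
  rewrite -[x k](subrK (xs n k)) (le_lt_trans (rnormD _ _)) // rnormB.
  by have := xs_x n k; rewrite -/(xs n k) in xke; lra.
(* The limit lies in ball j+1, where the [f] of [F j] chosen at stage j exceeds j. *)
have [j Fj] := Fpt x x0; have [uj /uS[_ _ _ [f]]] := gu j.
rewrite uj => /Fj fx /(_ x x0 (xs_x j.+1)).
by rewrite ltNge fx.
Qed.

End UniformBoundedness.

Lemma rnorm_limn_le (R : realType) (s : scalar_kind)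
    (V : normedModType (scalar_field R s)) (u : nat -> V) C :
  cvgn u -> (forall n, rnorm (u n) <= C) -> rnorm (limn u) <= C.
Proof.
move=> /cvgn_rnormP ul uC; apply/ler_addgt0Pr => e /ul[N /(_ N (leqnn _)) uN].
by rewrite -[limn u](subrK (u N)) (le_trans (rnormD _ _)) // addrC lerD // ltW.
Qed.

(** * Rows of a matrix and their group norms *)

Section Rows.
Variables (R : realType) (s : scalar_kind).
Variables (X Y : normedModType (scalar_field R s)) (A : opmatrix X Y).
Implicit Types (x y : nat -> X) (a : scalar_field R s).

Lemma series_row_lin n a x y :
  series (row_terms A n (fun k => x k + a *: y k)) =
  (fun m => series (row_terms A n x) m + a *: series (row_terms A n y) m).
Proof.
apply/funext => m; rewrite /series /= scaler_sumr -big_split /=.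
by apply: eq_bigr => k _; rewrite /row_terms linearD linearZ.
Qed.

Lemma dom_lin a x y : dom A x -> dom A y -> dom A (fun k => x k + a *: y k).
Proof.
move=> xA yA n; rewrite series_row_lin.
by apply: is_cvgD => //; apply: is_cvgZr.
Qed.

Lemma mxapp_lin n a x y : dom A x -> dom A y ->
  mxapp A (fun k => x k + a *: y k) n = mxapp A x n + a *: mxapp A y n.
Proof.
move=> xA yA; rewrite /mxapp series_row_lin.
by apply: limn_eq; apply: cvgD => //; apply: cvgZr.
Qed.

Lemma series_row_c0_bounded n m : c0_bounded (fun x => series (row_terms A n x) m).
Proof.
have /choice[M M0] : forall k, exists M, 0 <= M /\
    forall v, rnorm (A n k v) <= M * rnorm v.
  move=> k; have [M M0 MP] := bounded_op_rnorm (A n k).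
  by exists M.
exists (\sum_(0 <= k < m) M k) => x r r0 _ xr.
rewrite (le_trans (rnorm_sum _ _)) // mulr_suml ler_sum // => k _.
by have [Mk0 AM] := M0 k; rewrite (le_trans (AM _)) // ler_wpM2l.
Qed.

(** A finite family extended by zero is a null sequence on which the row series is eventually
    constant, so testing on null sequences covers every sum in the group norm. *)
Lemma group_norm_le n C :
  (forall x, x @ \oo --> (0 : X) -> (forall k, rnorm (x k) <= 1) ->
    rnorm (mxapp A x n) <= C) ->
  (group_norm A n <= C%:E)%E.
Proof.
move=> AC; apply: ge_ereal_sup => _ [F [x [x1 ->]]]; rewrite lee_fin.
pose y k := if k \in F then x k else 0; pose N := (\max_(k <- F) k).+1.
have yN k : (N <= k)%N -> y k = 0.
  move=> Nk; rewrite /y; case: ifPn => // kF.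
  by move: Nk; rewrite ltnNge (@leq_bigmax_seq _ _ xpredT id).
have -> : \sum_(k <- F) A n k (x k) = mxapp A y n.
  apply/esym/limn_eq/cvgn_rnormP => e e0; exists N => m Nm.
  suff -> : series (row_terms A n y) m = \sum_(k <- F) A n k (x k).
    by rewrite subrr rnorm0.
  rewrite /series /= (eq_bigr (fun k => if k \in F then A n k (x k) else 0)).
    rewrite -big_mkcond -big_filter; apply: perm_big.
    apply: uniq_perm; rewrite ?filter_uniq ?iota_uniq ?fset_uniq // => k.
    rewrite mem_filter mem_index_iota /=; case kF : (k \in F) => //=.
    by rewrite (leq_trans _ Nm) // ltnS (@leq_bigmax_seq _ _ xpredT id).
  by move=> k _; rewrite /row_terms /y; case: ifP; rewrite ?linear0.
apply: AC => [|k].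
  by apply/cvgn_rnormP => e e0; exists N => k /yN ->; rewrite subrr rnorm0.
by rewrite /y; case: ifP => // _; rewrite rnorm0.
Qed.

(** After division by [r], each partial sum is one of the sums in the group norm, and the bound
    survives the limit. Here [x] is bounded but need not be null. *)
Lemma rnorm_mxapp_le n C x r : (group_norm A n <= C%:E)%E -> dom A x -> 0 < r ->
  (forall k, rnorm (x k) <= r) -> rnorm (mxapp A x n) <= C * r.
Proof.
move=> AC xA r0 xr; apply: rnorm_limn_le => // m.
have ri0 : 0 <= r^-1 by rewrite invr_ge0 ltW.
rewrite -ler_pdivrMr // mulrC -rnormZ // -lee_fin; apply: le_trans AC.
apply: ereal_sup_ubound; exists [fset k in iota 0 m]%fset.
exists (fun k => scalar_of_real s r^-1 *: x k); split=> [k|].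
  by rewrite rnormZ // ler_pdivrMl // mulr1.
congr (rnorm _)%:E; rewrite /series /= scaler_sumr.
rewrite [RHS](perm_big (iota 0 m)) /=; last first.
  apply: uniq_perm; rewrite ?iota_uniq ?fset_uniq // => k.
  by rewrite in_fset.
by rewrite /index_iota subn0; apply: eq_bigr => k _; rewrite linearZ.
Qed.

End Rows.

Lemma ereal_sup_ltyP (R : realType) (S : set \bar R) :
  (ereal_sup S < +oo)%E <-> exists2 C : R, 0 <= C & forall r, S r -> (r <= C%:E)%E.
Proof.
split=> [Sy|[C _ SC]]; last first.
  by apply: le_lt_trans (ltry C); apply: ge_ereal_sup.
have := @ereal_sup_ubound _ S; case: (ereal_sup S) Sy => [C _|//|_] SC.
- exists `|C| => // r /SC /le_trans; apply.
  by rewrite lee_fin ler_norm.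
(* A supremum of -oo, as for an empty set, is bounded by 0. *)
- by exists 0 => // r /SC /le_trans; apply; rewrite leNye.
Qed.

(** * Ideals, dual filters and ideal convergence *)

Section Ideals.
Variables (I : set (set nat)).
Hypothesis idealI : is_ideal I.

Lemma ideal_set0 : I set0.
Proof. by apply: ideal_finite => //; apply: finite_set0. Qed.

Lemma dual_filterP S : dual_filter I S <-> I (~` S).
Proof.
split=> [[B IB <-]|IS]; first by rewrite setCK.
by exists (~` S) => //; rewrite setCK.
Qed.

Lemma dual_filterI S1 S2 :
  dual_filter I S1 -> dual_filter I S2 -> dual_filter I (S1 `&` S2).
Proof. by rewrite !dual_filterP setCI; apply: ideal_setU. Qed.

Variables (K : numFieldType) (X : normedModType K).

Lemma ideal_cvg_cst (eta : X) : ideal_cvg I (fun=> eta) eta.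
Proof.
by move=> U /nbhs_singleton Ueta; apply: ideal_subset ideal_set0.
Qed.

Lemma c00b_ideal_cvg0 x : c00b X I x -> ideal_cvg I x 0.
Proof.
move=> [_ Ix] U /nbhs_singleton U0; apply: ideal_subset Ix => //.
by move=> n /= nU; apply/eqP => xn0; apply: nU; rewrite xn0.
Qed.

Lemma c00b_cb : c00b X I `<=` cb X I.
Proof. by move=> x Ix; split; [case: Ix|exists 0; apply: c00b_ideal_cvg0]. Qed.

Lemma cb_cst (eta : X) : cb X I (fun=> eta).
Proof.
split; last by exists eta; apply: ideal_cvg_cst.
by apply: cvg_seq_bounded; apply: is_cvg_cst.
Qed.

Lemma cvg_ideal_cvg x (eta : X) : x @ \oo --> eta -> ideal_cvg I x eta.
Proof.
move=> xeta U /xeta[N _ NU]; apply: ideal_finite => //.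
apply: sub_finite_set (finite_II N) => n /= nU.
by rewrite ltnNge; apply/negP => /NU.
Qed.

(** For eta = 0 this places c_0(X) inside c^b(X, I), so that regularity can be tested on null
    sequences. *)
Lemma cvg_cb x (eta : X) : x @ \oo --> eta -> cb X I x.
Proof.
move=> xeta; split; last by exists eta; apply: cvg_ideal_cvg.
by apply: cvg_seq_bounded; apply/cvg_ex; exists eta.
Qed.

End Ideals.

(** * Necessity: bounds on group norms *)

Section Necessity.
Variables (R : realType) (s : scalar_kind).
Variables (X Y : completeNormedModType (scalar_field R s)).
Implicit Types (A : opmatrix X Y) (x : nat -> X).

Lemma mxapp_c0_linear A n :
  (forall x, x @ \oo --> (0 : X) -> dom A x) ->
  c0_linear (fun x => mxapp A x n).
Proof. by move=> domA a x y x0 y0; apply: mxapp_lin; apply: domA. Qed.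

Lemma mxapp_c0_bounded A n :
  (forall x, x @ \oo --> (0 : X) -> dom A x) ->
  c0_bounded (fun x => mxapp A x n).
Proof.
move=> domA.
(* With a family that does not depend on j, the principle is the ordinary Banach-Steinhaus theorem,
   here for the partial sums of one row. *)
pose F (_ : nat) := [set f | exists m, f = fun x => series (row_terms A n x) m].
have [||j [C FC]] := @c0_uniform_boundedness _ _ X Y F.
- move=> _ _ [m ->]; split; last exact: series_row_c0_bounded.
  by move=> a x y _ _; rewrite series_row_lin.
- move=> x /domA/(_ n)/cvg_seq_bounded/linfty_rnormP[M xM].
  exists (Num.truncn M).+1 => _ [m ->].
  by rewrite (le_trans (xM m)) // ltW // truncnS_gt.
apply: (@c0_bounded_unit _ _ _ _ _ C); first exact: mxapp_c0_linear.
move=> x x0 x1; apply: rnorm_limn_le => [|m]; first exact: domA.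
by apply: (FC (fun x => series (row_terms A n x) m)) => //; exists m.
Qed.

Lemma linfty_group_norm A :
  (forall x, x @ \oo --> (0 : X) -> dom A x /\ linfty (mxapp A x)) ->
  (ereal_sup [set group_norm A n | n in [set: nat]] < +oo)%E.
Proof.
move=> Ac0; have domA x : x @ \oo --> (0 : X) -> dom A x by case/Ac0.
pose F (_ : nat) := [set f | exists n, f = fun x => mxapp A x n].
have [||j [C FC]] := @c0_uniform_boundedness _ _ X Y F.
- by move=> _ _ [n ->]; split; [apply: mxapp_c0_linear|apply: mxapp_c0_bounded].
- move=> x /Ac0[_ /linfty_rnormP[M xM]].
  exists (Num.truncn M).+1 => _ [n ->].
  by rewrite (le_trans (xM n)) // ltW // truncnS_gt.
apply: le_lt_trans (ltry C); apply: ge_ereal_sup => _ [n _ <-].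
apply: group_norm_le => x x0 x1.
by apply: (FC (fun x => mxapp A x n)) => //; exists n.
Qed.

(** Each member of [J] lies in one of the increasing sets [B j], so for each null [x] all matrices
    have values below 1 on the rows outside some [B j]. Uniform boundedness yields a single j, and
    the complement of [B j] is the required set. *)
Lemma unif_ideal_lim_group_norm (J : set (set nat)) (AA : set (opmatrix X Y)) :
  countably_generated J ->
  (forall A x, AA A -> x @ \oo --> (0 : X) -> dom A x) ->
  (forall x, x @ \oo --> (0 : X) -> unif_ideal_lim J AA x 0) ->
  exists2 S, dual_filter J S &
    (ereal_sup [set ereal_sup [set group_norm A n | n in S] | A in AA] < +oo)%E.
Proof.
move=> [S [_ JS]] domAA limAA; pose B j := \bigcup_(i in `I_j) S i.
have JB j : J (B j) by apply/JS; exists `I_j => //; apply: finite_II.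
pose F j := [set f | exists A n,
  [/\ AA A, ~ B j n & f = fun x => mxapp A x n]].
have [||j [C FC]] := @c0_uniform_boundedness _ _ X Y F.
- move=> j _ [A [n [AAA _ ->]]].
  by split; [apply: mxapp_c0_linear|apply: mxapp_c0_bounded] => x; apply: domAA.
- move=> x /limAA/(_ [set y | rnorm y < 1])[|_ [D JD <-] DA].
    apply/nbhs_rnormP; exists 1 => // w.
    by rewrite sub0r rnormN.
  have [G finG DG] := (JS D).1 JD.
  have [N GN] : exists N, G `<=` `I_N.
    have /finite_fsetP[H ->] := finG.
    exists (\max_(k <- H) k).+1 => k kH /=.
    by rewrite ltnS (@leq_bigmax_seq _ _ xpredT id).
  (* The successor makes the bound 1 at most j, while [B N.+1] still covers the exceptional set
     [D]. *)
  exists N.+1 => _ [A [n [AAA nB ->]]].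
  apply: (@le_trans _ _ 1); last by rewrite ler1n.
  apply/ltW/DA => // /DG[i Gi Sin]; apply: nB; exists i => //=.
  by apply: ltnW; apply: GN.
exists (~` B j); first by exists (B j).
apply: le_lt_trans (ltry C); apply: ge_ereal_sup => _ [A AAA <-].
apply: ge_ereal_sup => _ [n nB <-]; apply: group_norm_le => x x0 x1.
by apply: (FC (fun x => mxapp A x n)) => //; exists A, n.
Qed.

End Necessity.

(** * Sufficiency: splitting a convergent sequence *)

Section Sufficiency.
Variables (R : realType) (s : scalar_kind).
Variables (X Y : completeNormedModType (scalar_field R s)).
Variables (AA : set (opmatrix X Y)) (T : bounded_op X Y).
Variables (I J : set (set nat)).
Hypotheses (idealI : is_ideal I) (idealJ : is_ideal J).

Lemma unif_ideal_lim_cb x eta :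
  (exists2 S, dual_filter J S &
    (ereal_sup [set ereal_sup [set group_norm A n | n in S] | A in AA]
      < +oo)%E) ->
  (forall A, AA A -> cb X I `<=` dom A) ->
  (forall x : X, unif_ideal_lim J AA (fun=> x) (T x)) ->
  (forall x, c00b X I x -> unif_ideal_lim J AA x 0) ->
  cb X I x -> ideal_cvg I x eta -> unif_ideal_lim J AA x (T eta).
Proof.
move=> [S JS /ereal_sup_ltyP[C C0 AC]] domAA limcst lim0 xI xeta U.
move=> /nbhs_rnormP[e e0 eU].
have e30 : 0 < e / 3 by rewrite divr_gt0.
have C10 : 0 < C + 1 by rewrite ltr_pwDr.
(* This threshold gives C d < e/3; adding 1 to [C] avoids a zero divisor. *)
pose d := e / 3 / (C + 1); have d0 : 0 < d by rewrite divr_gt0.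
pose z n := if rnorm (eta - x n) < d then 0 else x n - eta.
pose w n := if rnorm (eta - x n) < d then x n - eta else 0.
have zI : c00b X I z.
  split.
    have [/linfty_rnormP[M xM] _] := xI.
    apply/linfty_rnormP; exists (M + rnorm eta) => n; rewrite /z; case: ifP => _.
      by rewrite rnorm0 addr_ge0 ?rnorm_ge0 // (le_trans _ (xM n)) ?rnorm_ge0.
    by rewrite (le_trans (rnormD _ _)) // rnormN lerD2r.
  (* The support of [z] lies where [x] is at distance at least d from eta, a set of [I] by
     convergence. *)
  apply: ideal_subset (xeta [set y | rnorm (eta - y) < d] _) => //.
    by move=> n /=; rewrite /z; case: ifP => //; rewrite eqxx.
  by apply/nbhs_rnormP; exists d.
(* In this shape, linearity gives both that [w] is in the domain and that A x splits into three
   terms. *)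
have wE : w = fun k => x k + (-1) *: (eta + 1 *: z k).
  apply/funext => k; rewrite /w /z scale1r scaleN1r.
  by case: ifP => _; rewrite ?addr0 // subrKC subrr.
have wd k : rnorm (w k) <= d.
  rewrite /w; case: ifP => [/ltW|_]; first by rewrite rnormB.
  by rewrite rnorm0 ltW.
have [|S1 JS1 S1P] := limcst eta [set y | rnorm (T eta - y) < e / 3].
  by apply/nbhs_rnormP; exists (e / 3).
have [|S2 JS2 S2P] := lim0 z zI [set y | rnorm (0 - y) < e / 3].
  by apply/nbhs_rnormP; exists (e / 3).
exists (S `&` (S1 `&` S2)); first by do 2?apply: dual_filterI.
move=> n A [Sn [S1n S2n]] AAA; apply: eU.
have dx := domAA _ AAA _ xI.
have deta := domAA _ AAA _ (cb_cst idealI eta).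
have dz := domAA _ AAA _ (c00b_cb idealI zI).
have detaz : dom A (fun k => eta + 1 *: z k) by apply: dom_lin.
have dw : dom A w by rewrite wE; apply: dom_lin.
have Aw : rnorm (mxapp A w n) < e / 3.
  have Cd : C * d < e / 3.
    rewrite /d mulrA ltr_pdivrMr // mulrC ltr_pM2l // ltrDl //.
  apply: le_lt_trans Cd; apply: rnorm_mxapp_le => //.
  apply: le_trans (AC _ (ex_intro2 _ _ A AAA erefl)).
  by apply: ereal_sup_ubound; exists n.
have -> : mxapp A x n = mxapp A (fun=> eta) n + mxapp A z n + mxapp A w n.
  by rewrite wE !mxapp_lin // scaleN1r scale1r subrKC.
have := S1P n A S1n AAA; have := S2P n A S2n AAA => /=.
rewrite sub0r rnormN => Az Aeta.
rewrite !opprD !addrA (le_lt_trans (rnormD _ _)) // rnormN.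
rewrite (le_lt_trans (lerD (rnormD _ _) (lexx _))) // rnormN.
by lra.
Qed.

Lemma linfty_mxapp (A : opmatrix X Y) x :
  (ereal_sup [set group_norm A n | n in [set: nat]] < +oo)%E ->
  dom A x -> linfty x -> linfty (mxapp A x).
Proof.
move=> /ereal_sup_ltyP[C _ AC] xA /linfty_rnormP[M xM]; apply/linfty_rnormP.
(* The row estimate needs a positive radius, which [M] itself may fail to be. *)
exists (C * (`|M| + 1)) => n; apply: rnorm_mxapp_le => //.
  by apply: AC; exists n.
by move=> k; rewrite (le_trans (xM k)) // ler_wpDr // ler_norm.
Qed.

Lemma unif_ideal_lim_cvg (A : opmatrix X Y) x eta :
  AA A -> unif_ideal_lim J AA x eta -> ideal_cvg J (mxapp A x) eta.
Proof.
move=> AAA xeta U /xeta[S /dual_filterP JS SU].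
by apply: ideal_subset JS => // n /= nU Sn; apply: nU; apply: SU.
Qed.

End Sufficiency.

(** * Characterization of regularity *)

Theorem theorem2p3 (R : realType) (s : scalar_kind)
  (X Y : completeNormedModType (scalar_field R s))
  (AA : set (opmatrix X Y)) (AA_nonempty : AA !=set0)
  (T : bounded_op X Y)
  (I J : set (set nat)) (idealI : is_ideal I) (idealJ : is_ideal J)
  (cgJ : countably_generated J) :
  ideal_regular I J AA T <->
  [/\ (* U1 *) forall A, AA A ->
        (ereal_sup [set group_norm A n | n in [set: nat]] < +oo)%E,
      (* U2 *) exists2 S, dual_filter J S &
        (ereal_sup [set ereal_sup [set group_norm A n | n in S] | A in AA]
          < +oo)%E,
      (* U3 *) forall A, AA A -> cb X I `<=` dom A,
      (* U4 *) forall x : X, unif_ideal_lim J AA (fun=> x) (T x) &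
      (* U5 *) forall x, c00b X I x -> unif_ideal_lim J AA x 0].
Proof.
split=> [[AAreg AAlim]|[U1 U2 U3 U4 U5]].
  have domAA A x : AA A -> x @ \oo --> (0 : X) -> dom A x.
    by move=> /AAreg[+ _] x0; apply; apply: cvg_cb x0.
  (* This identifies the limit T 0 supplied by regularity with the limit 0 needed for U2 and U5. *)
  have T0 : T 0 = 0 by rewrite linear0.
  split=> [A AAA||A /AAreg[]//|x|x xI].
  - apply: linfty_group_norm => x x0; split; first exact: domAA.
    by have [_ /(_ x (cvg_cb idealI x0))[]] := AAreg A AAA.
  - apply: unif_ideal_lim_group_norm => // x x0; rewrite -T0.
    by apply: AAlim; [apply: cvg_cb x0|apply: cvg_ideal_cvg].
  - by apply: AAlim; [apply: cb_cst|apply: ideal_cvg_cst].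
  - by rewrite -T0; apply: AAlim; [apply: c00b_cb|apply: c00b_ideal_cvg0].
(* The uniform limit comes first because it also supplies the [J]-limit needed for A x to lie in
   c^b(Y, J); boundedness of A x comes from U1. *)
have lim x eta : cb X I x -> ideal_cvg I x eta -> unif_ideal_lim J AA x (T eta).
  exact: unif_ideal_lim_cb.
split=> [A AAA|//]; split; first exact: U3.
move=> x xI; have [xb [eta xeta]] := xI; split.
  by apply: linfty_mxapp; [apply: U1|apply: U3|].
by exists (T eta); apply: unif_ideal_lim_cvg (lim _ _ xI xeta).
Qed.
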